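(* Let $\mathbb{K}$ be an algebraically closed field of characteristic zero, let $G$ be a commutative linear algebraic group over $\mathbb{K}$, and let $V$ be a finite dimensional cyclic $G$-module on which $G$ acts effectively. Then there exist a finite dimensional commutative associative $\mathbb{K}$-algebra $A$ with unit and an injective homomorphism of algebraic groups $G\to G(A)$ such that the $G$-modules $V$ and $A$ are isomorphic, where $G$ acts on $A$ through $G\to G(A)$ by multiplication.
   Context: A vector $v$ in a $G$-module $V$ is cyclic if the linear span of the orbit $Gv$ coincides with $V$; a $G$-module is cyclic if it has a cyclic vector. For a finite dimensional commutative associative unital algebra $A$, $G(A)$ denotes the (linear algebraic) group of invertible elements of $A$, acting linearly on $A$ by multiplication. *)

(* Defs.v *)
From HB Require Import structures.
From mathcomp Require Import all_boot all_order all_algebra.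
From mathcomp Require Import mpoly.

Set Implicit Arguments.
Unset Strict Implicit.
Unset Printing Implicit Defensive.

Import GRing.Theory.
Local Open Scope ring_scope.

(* The common zero locus of an arbitrary family of polynomials. *)
Definition zariski_closed (K : fieldType) (n : nat)
    (S : {ffun 'I_n -> K} -> Prop) : Prop :=
  exists I : {mpoly K[n]} -> Prop,
    forall x, S x <-> (forall p, I p -> p.@[x] = 0).

(* An affine variety (reduced, not necessarily irreducible), given by its set
   of K-points and a closed embedding into an affine space.  The embedding is
   only used through the regular functions it defines: morphisms below are the
   maps that pull regular functions back to regular functions. *)
HB.mixin Record isAffineVariety (K : fieldType) X of Choice X := {
  adim : nat;
  acoord : X -> {ffun 'I_adim -> K};
  acoord_inj : injective acoord;
  acoord_closed : zariski_closed (fun c => exists x, acoord x = c)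
}.

#[short(type="affineVarietyType")]
HB.structure Definition AffineVariety (K : fieldType) :=
  { X of isAffineVariety K X & Choice X }.

Definition regular (K : fieldType) (X : affineVarietyType K) (f : X -> K) :=
  exists p : {mpoly K[@adim K X]}, forall x, f x = p.@[acoord x].

Definition variety_morphism (K : fieldType) (X Y : affineVarietyType K)
    (phi : X -> Y) :=
  forall f : Y -> K, regular f -> regular (f \o phi).

Section Substitution.
Variables (K : fieldType) (n k : nat).

Lemma meval_subst (q : 'I_n -> {mpoly K[k]}) (p : {mpoly K[n]}) :
  exists r : {mpoly K[k]},
    forall v : 'I_k -> K, r.@[v] = p.@[fun i => (q i).@[v]].
Proof.
exists (p \mPo [tuple q i | i < n]) => v.
rewrite comp_mpolyEX raddf_sum /= mevalE; apply: eq_bigr => m _.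
rewrite mevalZ; congr (_ * _); rewrite comp_mpolyX rmorph_prod /=.
by apply: eq_bigr => i _; rewrite rmorphXn /= tnth_mktuple.
Qed.

End Substitution.

Lemma regular_comp (K : fieldType) (X Y : affineVarietyType K) (phi : X -> Y) :
  (forall i, regular (fun x => acoord (phi x) i)) -> variety_morphism phi.
Proof.
move=> reg f [p fE].
have /(@fin_all_exists _ (fun=> {mpoly K[@adim K X]})) [q qE] :
    forall i, exists r : {mpoly K[@adim K X]},
      forall x, acoord (phi x) i = r.@[acoord x] by exact: reg.
have [r rE] := meval_subst q p.
exists r => x; rewrite /= fE rE; apply: meval_eq => i; exact: qE.
Qed.

Section Product.
Variables (K : fieldType) (X Y : affineVarietyType K).

Definition prod_acoord (z : X * Y) : {ffun 'I_(@adim K X + @adim K Y) -> K} :=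
  [ffun i => match split i with
             | inl j => acoord z.1 j
             | inr j => acoord z.2 j
             end].

Lemma prod_acoordl z j : prod_acoord z (lshift _ j) = acoord z.1 j.
Proof. by rewrite ffunE (unsplitK (inl j)). Qed.

Lemma prod_acoordr z j : prod_acoord z (rshift _ j) = acoord z.2 j.
Proof. by rewrite ffunE (unsplitK (inr j)). Qed.

Fact prod_acoord_inj : injective prod_acoord.
Proof.
move=> [x y] [x' y'] /ffunP e; congr pair; apply: acoord_inj; apply/ffunP => j.
  by have := e (lshift _ j); rewrite !prod_acoordl.
by have := e (rshift _ j); rewrite !prod_acoordr.
Qed.

Fact prod_acoord_closed : zariski_closed (fun c => exists z, prod_acoord z = c).
Proof.
have [I IE] := @acoord_closed K X; have [J JE] := @acoord_closed K Y.
exists (fun p => exists q,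
  (I q /\ forall c : {ffun 'I_(@adim K X + @adim K Y) -> K},
     p.@[c] = q.@[[ffun j => c (lshift _ j)]]) \/
  exists q, J q /\ forall c : {ffun 'I_(@adim K X + @adim K Y) -> K},
     p.@[c] = q.@[[ffun j => c (rshift _ j)]]) => c; split.
  case=> z <- p [q [[Iq ->]|[{}q [Jq ->]]]].
    apply: (IE _).1 Iq; exists z.1; apply/ffunP => j.
    by rewrite ffunE prod_acoordl.
  apply: (JE _).1 Jq; exists z.2; apply/ffunP => j.
  by rewrite ffunE prod_acoordr.
move=> c0.
have /IE [x xE] : forall p, I p -> p.@[[ffun j => c (lshift _ j)]] = 0.
  move=> p Ip; have [r rE] := meval_subst (fun j => 'X_(lshift (@adim K Y) j)) p.
  have rE' (d : {ffun 'I__ -> K}) : r.@[d] = p.@[[ffun j => d (lshift _ j)]].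
    by rewrite rE; apply: meval_eq => j; rewrite mevalXU ffunE.
  by rewrite -rE'; apply: c0; exists p; left.
have /JE [y yE] : forall p, J p -> p.@[[ffun j => c (rshift _ j)]] = 0.
  move=> p Jp; have [r rE] := meval_subst (fun j => 'X_(rshift (@adim K X) j)) p.
  have rE' (d : {ffun 'I__ -> K}) : r.@[d] = p.@[[ffun j => d (rshift _ j)]].
    by rewrite rE; apply: meval_eq => j; rewrite mevalXU ffunE.
  by rewrite -rE'; apply: c0; exists 0; right; exists p.
exists (x, y); apply/ffunP => i; case: (split_ordP i) => j ->.
  by rewrite prod_acoordl /= xE ffunE.
by rewrite prod_acoordr /= yE ffunE.
Qed.

HB.instance Definition _ := isAffineVariety.Build K (X * Y)%type
  prod_acoord_inj prod_acoord_closed.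

End Product.

HB.mixin Record isAlgebraicGroup (K : fieldType) G
    of Group G & AffineVariety K G := {
  mulg_morphism : variety_morphism (fun z : G * G => (z.1 * z.2)%g);
  invg_morphism : variety_morphism (fun g : G => g^-1%g)
}.

#[short(type="linAlgGroupType")]
HB.structure Definition LinAlgGroup (K : fieldType) :=
  { G of Group G & AffineVariety K G & isAlgebraicGroup K G }.

Record alg_group_hom (K : fieldType) (G H : linAlgGroupType K) := AlgGroupHom {
  alg_group_hom_fun :> G -> H;
  alg_group_homM : {morph alg_group_hom_fun : g h / (g * h)%g};
  alg_group_hom_morphism : variety_morphism alg_group_hom_fun
}.

(* A finite dimensional G-module is a vectType V with a rational (= algebraic)
   representation of G in V: all matrix coefficients are regular on G. *)
Record rational_repr (K : fieldType) (G : linAlgGroupType K) (V : vectType K) :=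
  RationalRepr {
    repr_fun :> G -> 'End(V);
    repr_fun1 : repr_fun 1%g = \1%VF;
    repr_funM : forall g h, repr_fun (g * h)%g = (repr_fun g \o repr_fun h)%VF;
    repr_fun_regular :
      forall (xi : 'Hom(V, K^o)) (v : V), regular (fun g => xi (repr_fun g v))
  }.

Definition effective (K : fieldType) (G : linAlgGroupType K) (V : vectType K)
    (rho : rational_repr G V) :=
  forall g : G, (forall v, rho g v = v) -> g = 1%g.

(* The orbit may be infinite; its linear span is the union of the spans of its
   finite subfamilies. *)
Definition cyclic_vector (K : fieldType) (G : linAlgGroupType K)
    (V : vectType K) (rho : rational_repr G V) (v : V) :=
  forall w : V, exists s : seq G, w \in <<[seq rho g v | g <- s]>>%VS.

Definition cyclic_repr (K : fieldType) (G : linAlgGroupType K)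
    (V : vectType K) (rho : rational_repr G V) :=
  exists v : V, cyclic_vector rho v.

Definition repr_iso (K : fieldType) (G : linAlgGroupType K) (V W : vectType K)
    (rho : rational_repr G V) (sigma : rational_repr G W) :=
  exists f : 'Hom(V, W),
    bijective f /\ forall g v, f (rho g v) = sigma g (f v).

Section Restriction.
Variables (K : fieldType) (G H : linAlgGroupType K) (phi : alg_group_hom G H).
Variables (V : vectType K) (rho : rational_repr H V).

Fact restrict_repr1 : rho (phi 1%g) = \1%VF.
Proof.
suff -> : phi 1%g = 1%g by exact: repr_fun1.
by apply: (@mulgI H (phi 1%g)); rewrite -alg_group_homM !mulg1.
Qed.

Fact restrict_reprM g h : rho (phi (g * h)%g) = (rho (phi g) \o rho (phi h))%VF.
Proof. by rewrite alg_group_homM repr_funM. Qed.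

Fact restrict_repr_regular (xi : 'Hom(V, K^o)) v :
  regular (fun g => xi (rho (phi g) v)).
Proof.
exact: (@alg_group_hom_morphism _ _ _ phi _ (repr_fun_regular rho xi v)).
Qed.

(* H-modules viewed as G-modules through phi : G -> H. *)
Definition restrict_repr : rational_repr G V :=
  RationalRepr restrict_repr1 restrict_reprM restrict_repr_regular.

End Restriction.

(* Finite dimensional commutative associative unital algebras.  The library's
   algType and falgType require 1 != 0; here the zero algebra is allowed (it
   corresponds to the module V = 0).  The record is stated with explicit
   operations because Hierarchy-Builder admits no structure that inherits from
   both comPzRingType and vectType without going through algType. *)
Record finComAlg (K : fieldType) := FinComAlg {
  fca_space : vectType K;
  fca_one : fca_space;
  fca_mul : fca_space -> fca_space -> fca_space;
  fca_mulA : associative fca_mul;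
  fca_mulC : commutative fca_mul;
  fca_mul1 : left_id fca_one fca_mul;
  fca_linear : forall y, linear (fca_mul ^~ y)
}.

Definition fca_sort (K : fieldType) (A : finComAlg K) : Type := fca_space A.
Coercion fca_sort : finComAlg >-> Sortclass.

Section FinComAlgTheory.
Variables (K : fieldType) (A : finComAlg K).

HB.instance Definition _ := Vector.on (fca_sort A).

Fact fca_mulDl : left_distributive (@fca_mul K A) +%R.
Proof.
by move=> x y z; have := fca_linear z 1 x y; rewrite !scale1r.
Qed.

HB.instance Definition _ := GRing.Zmodule_isComPzRing.Build (fca_sort A)
  (@fca_mulA K A) (@fca_mulC K A) (@fca_mul1 K A) fca_mulDl.

Lemma fca_scalerAl (k : K) (x y : A) : k *: (x * y) = (k *: x) * y.
Proof.
have e : (k *: x + 0) * y = k *: (x * y) + 0 * y := fca_linear y k x 0.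
by rewrite addr0 mul0r addr0 in e.
Qed.

End FinComAlgTheory.

(* The group G(A) of invertible elements of A: an element is stored with its
   (unique) inverse, as a point (a, b) of the closed subset ab = 1 of A x A. *)
Definition unit_group (K : fieldType) (A : finComAlg K) : Type :=
  {p : A * A | p.1 * p.2 == 1}.

Section UnitGroup.
Variables (K : fieldType) (A : finComAlg K).
Implicit Types (u w : unit_group A).

HB.instance Definition _ := SubType.on (unit_group A).
HB.instance Definition _ := [Choice of unit_group A by <:].

Definition unit_val u : A := (val u).1.
Definition unit_inv u : A := (val u).2.

Lemma unit_valV u : unit_val u * unit_inv u = 1.
Proof. exact/eqP/(valP u). Qed.

Lemma unit_val_inj : injective unit_val.
Proof.
move=> u w e; apply: val_inj; move: (unit_valV u) (unit_valV w) (e).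
rewrite /unit_val /unit_inv; case: (val u) (val w) => [a b] [c d] /= ab cd ac.
by congr pair => //; rewrite -[b]mul1r -cd mulrAC -ac ab mul1r.
Qed.

Definition unit_pair (a b : A) (ab : a * b = 1) : unit_group A :=
  exist _ (a, b) (introT eqP ab).

Fact unit_one_subproof : 1 * 1 = 1 :> A. Proof. exact: mul1r. Qed.

Fact unit_inv_subproof u : unit_inv u * unit_val u = 1.
Proof. by rewrite mulrC unit_valV. Qed.

Fact unit_mul_subproof u w :
  (unit_val u * unit_val w) * (unit_inv u * unit_inv w) = 1.
Proof. by rewrite mulrACA !unit_valV mulr1. Qed.

Definition unit_one := unit_pair unit_one_subproof.
Definition unit_invg u := unit_pair (unit_inv_subproof u).
Definition unit_mul u w := unit_pair (unit_mul_subproof u w).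

Fact unit_mulA : associative unit_mul.
Proof. by move=> x y z; apply: unit_val_inj; exact: mulrA. Qed.
Fact unit_mul1 : left_id unit_one unit_mul.
Proof. by move=> x; apply: unit_val_inj; exact: mul1r. Qed.
Fact unit_mulr1 : right_id unit_one unit_mul.
Proof. by move=> x; apply: unit_val_inj; exact: mulr1. Qed.
Fact unit_mulV : left_inverse unit_one unit_invg unit_mul.
Proof. by move=> x; apply: unit_val_inj; exact: unit_inv_subproof. Qed.
Fact unit_mulrV : right_inverse unit_one unit_invg unit_mul.
Proof. by move=> x; apply: unit_val_inj; exact: unit_valV. Qed.

HB.instance Definition _ := isGroup.Build (unit_group A)
  unit_mulA unit_mul1 unit_mulr1 unit_mulV unit_mulrV.

Let d := \dim {:A}.
Let cf (i : 'I_d) (a : A) : K := coord (vbasis {:A}) i a.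

Let cfE a : a = \sum_(i < d) cf i a *: (vbasis {:A})`_i.
Proof. exact: coord_vbasis (memvf a). Qed.

Let cf_inj a b : (forall i, cf i a = cf i b) -> a = b.
Proof. by move=> e; rewrite [a]cfE [b]cfE; apply: eq_bigr => i _; rewrite e. Qed.

Let cfM k a b : cf k (a * b) = \sum_(i < d) \sum_(j < d)
  cf i a * cf j b * cf k ((vbasis {:A})`_i * (vbasis {:A})`_j).
Proof.
have scalAr (c : K) (x y : A) : x * (c *: y) = c *: (x * y).
  by rewrite mulrC -fca_scalerAl mulrC.
rewrite {1}[a]cfE {1}[b]cfE mulr_suml /cf linear_sum; apply: eq_bigr => i _.
rewrite mulr_sumr linear_sum; apply: eq_bigr => j _ /=.
by rewrite -fca_scalerAl scalAr scalerA linearZ.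
Qed.

Definition unit_acoord u : {ffun 'I_(\dim {:A} + \dim {:A}) -> K} :=
  [ffun i => match split i with
             | inl j => coord (vbasis {:A}) j (unit_val u)
             | inr j => coord (vbasis {:A}) j (unit_inv u)
             end].

Lemma unit_acoordl u j :
  unit_acoord u (lshift _ j) = coord (vbasis {:A}) j (unit_val u).
Proof. by rewrite ffunE (unsplitK (inl j)). Qed.

Lemma unit_acoordr u j :
  unit_acoord u (rshift _ j) = coord (vbasis {:A}) j (unit_inv u).
Proof. by rewrite ffunE (unsplitK (inr j)). Qed.

Fact unit_acoord_inj : injective unit_acoord.
Proof.
move=> u w /ffunP e; apply: unit_val_inj; apply: cf_inj => j.
by have := e (lshift _ j); rewrite !unit_acoordl.
Qed.

Fact unit_acoord_closed : zariski_closed (fun c => exists u, unit_acoord u = c).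
Proof.
pose L (c : {ffun 'I_(d + d) -> K}) : A :=
  \sum_(i < d) c (lshift d i) *: (vbasis {:A})`_i.
pose R (c : {ffun 'I_(d + d) -> K}) : A :=
  \sum_(i < d) c (rshift d i) *: (vbasis {:A})`_i.
have fr : free (vbasis {:A}) := basis_free (vbasisP _).
have cfL c i : cf i (L c) = c (lshift d i) by exact: coord_sum_free.
have cfR c i : cf i (R c) = c (rshift d i) by exact: coord_sum_free.
pose Q (k : 'I_d) : {mpoly K[d + d]} := (\sum_(i < d) \sum_(j < d)
  (cf k ((vbasis {:A})`_i * (vbasis {:A})`_j) *: ('X_(lshift d i) * 'X_(rshift d j))))
  - (cf k 1)%:MP.
have QE k (c : {ffun 'I_(d + d) -> K}) : (Q k).@[c] = cf k (L c * R c) - cf k 1.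
  rewrite mevalB mevalC cfM; congr (_ - _).
  rewrite raddf_sum; apply: eq_bigr => i _; rewrite raddf_sum.
  apply: eq_bigr => j _ /=.
  by rewrite mevalZ rmorphM /= !mevalXU cfL cfR mulrC.
exists (fun p => exists k, p = Q k) => c; split.
  case=> u <- _ [k ->]; rewrite QE.
  have -> : L (unit_acoord u) = unit_val u.
    by apply: cf_inj => i; rewrite cfL unit_acoordl.
  have -> : R (unit_acoord u) = unit_inv u.
    by apply: cf_inj => i; rewrite cfR unit_acoordr.
  by rewrite unit_valV subrr.
move=> c0; have LR : L c * R c = 1.
  apply: cf_inj => k; apply/eqP; rewrite -subr_eq0 -QE; apply/eqP.
  by apply: c0; exists k.
exists (unit_pair LR); apply/ffunP => i; case: (split_ordP i) => j ->.
  by rewrite unit_acoordl; exact: cfL.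
by rewrite unit_acoordr; exact: cfR.
Qed.

HB.instance Definition _ := isAffineVariety.Build K (unit_group A)
  unit_acoord_inj unit_acoord_closed.

Fact unit_mul_morphism :
  variety_morphism (fun z : unit_group A * unit_group A => (z.1 * z.2)%g).
Proof.
apply: regular_comp => k; case: (split_ordP k) => l ->.
  exists (\sum_(i < d) \sum_(j < d)
    cf l ((vbasis {:A})`_i * (vbasis {:A})`_j) *:
      ('X_(lshift (d + d) (lshift d i)) * 'X_(rshift (d + d) (lshift d j)))).
  move=> z; rewrite [LHS]unit_acoordl [LHS]cfM.
  rewrite raddf_sum; apply: eq_bigr => i _; rewrite raddf_sum.
  apply: eq_bigr => j _ /=.
  rewrite mevalZ rmorphM /= !mevalXU [_ * _ in LHS]mulrC; congr (_ * (_ * _)).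
    by rewrite [RHS](prod_acoordl z) [RHS]unit_acoordl.
  by rewrite [RHS](prod_acoordr z) [RHS]unit_acoordl.
exists (\sum_(i < d) \sum_(j < d)
  cf l ((vbasis {:A})`_i * (vbasis {:A})`_j) *:
    ('X_(lshift (d + d) (rshift d i)) * 'X_(rshift (d + d) (rshift d j)))).
move=> z; rewrite [LHS]unit_acoordr [LHS]cfM.
rewrite raddf_sum; apply: eq_bigr => i _; rewrite raddf_sum.
apply: eq_bigr => j _ /=.
rewrite mevalZ rmorphM /= !mevalXU [_ * _ in LHS]mulrC; congr (_ * (_ * _)).
  by rewrite [RHS](prod_acoordl z) [RHS]unit_acoordr.
by rewrite [RHS](prod_acoordr z) [RHS]unit_acoordr.
Qed.

Fact unit_inv_morphism : variety_morphism (fun u : unit_group A => u^-1%g).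
Proof.
apply: regular_comp => k; case: (split_ordP k) => l ->.
  exists 'X_(rshift d l) => u.
  by rewrite mevalXU [LHS]unit_acoordl [RHS]unit_acoordr.
exists 'X_(lshift d l) => u.
by rewrite mevalXU [LHS]unit_acoordr [RHS]unit_acoordl.
Qed.

HB.instance Definition _ := isAlgebraicGroup.Build K (unit_group A)
  unit_mul_morphism unit_inv_morphism.

Definition unit_act (u : unit_group A) : 'End(A) :=
  linfun (fun a : A => unit_val u * a).

Lemma unit_actE u a : unit_act u a = unit_val u * a.
Proof.
have lin : linear (fun a : A => unit_val u * a).
  move=> k x y; rewrite mulrDr; congr (_ + _).
  by rewrite mulrC -fca_scalerAl mulrC.
pose F := GRing.isLinear.Build K A A *:%R (fun a : A => unit_val u * a) lin.
pose f : {linear A -> A} := HB.pack (fun a : A => unit_val u * a) F.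
exact: (lfunE f).
Qed.

Fact unit_act1 : unit_act 1%g = \1%VF.
Proof. by apply/lfunP => a; rewrite unit_actE id_lfunE; exact: mul1r. Qed.

Fact unit_actM u w : unit_act (u * w)%g = (unit_act u \o unit_act w)%VF.
Proof.
by apply/lfunP => a; rewrite comp_lfunE !unit_actE; symmetry; exact: mulrA.
Qed.

Fact unit_act_regular (xi : 'Hom(A, K^o)) (a : A) :
  regular (fun u : unit_group A => xi (unit_act u a)).
Proof.
exists (\sum_(i < d) xi ((vbasis {:A})`_i * a) *: 'X_(lshift d i)) => u.
rewrite unit_actE {1}[unit_val u]cfE mulr_suml linear_sum raddf_sum /=.
apply: eq_bigr => i _; rewrite mevalZ mevalXU [X in _ = _ * X]unit_acoordl.
rewrite -fca_scalerAl linearZ; exact: mulrC.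
Qed.

(* A as a G(A)-module, the action being multiplication. *)
Definition unit_repr : rational_repr (unit_group A) A :=
  RationalRepr unit_act1 unit_actM unit_act_regular.

End UnitGroup.

(* Main.v *)
Require Import Defs.
From mathcomp Require Import all_boot all_order all_algebra.

Set Implicit Arguments.
Unset Strict Implicit.
Unset Printing Implicit Defensive.
Local Open Scope ring_scope.

Import GRing.Theory.

(** Let [v0] be a cyclic vector.  Since [G] is commutative, for every [w] there
    is exactly one operator [T w] in the span of [rho G] with [T w v0 = w].  The
    product [w * w' = T w w'] makes [V] itself into the required algebra, with
    unit [v0], and [g |-> rho g v0] is the required embedding. *)

Section OrbitAlgebra.
Variables (K : fieldType) (G : linAlgGroupType K) (V : vectType K).
Variables (rho : rational_repr G V) (v0 : V).

(** Finite dimension lets one finite family suffice: concatenate the families whose spans catch the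
    successive vectors of a basis. *)
Lemma cyclic_vector_spanning_seq : cyclic_vector rho v0 ->
  exists s : seq G, <<[seq rho g v0 | g <- s]>>%VS = fullv.
Proof.
move=> cyc.
suff [s sub] : exists s : seq G,
    {subset (vbasis {:V} : seq V) <= <<[seq rho g v0 | g <- s]>>%VS}.
  exists s; apply/eqP; rewrite eqEsubv subvf /= -(span_basis (vbasisP {:V})).
  exact/span_subvP.
elim: (vbasis {:V} : seq V) => [|w b [s IHs]]; first by exists [::] => x; rewrite in_nil.
have [t wt] := cyc w; exists (t ++ s) => x.
rewrite map_cat span_cat inE => /predU1P[->|/IHs xs].
  exact: (subvP (addvSl _ _)).
exact: (subvP (addvSr _ _)).
Qed.

Hypothesis commG : forall g h : G, commute g h.
Variable s : seq G.
Hypothesis span_s : <<[seq rho g v0 | g <- s]>>%VS = fullv.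

Let orbit_tuple := [tuple rho (tnth (in_tuple s) i) v0 | i < size s].

(** The orbit vectors may be linearly dependent; [coord] still selects coefficients that depend
    linearly on [w] and recover it, so the choice of operator is linear in [w]. *)
Definition orbit_op (w : V) : 'End(V) :=
  \sum_(i < size s) coord orbit_tuple i w *: rho (tnth (in_tuple s) i).

Lemma orbit_op_linear : linear orbit_op.
Proof.
move=> k x y; rewrite /orbit_op scaler_sumr -big_split /=.
by apply: eq_bigr => i _; rewrite linearP scalerDl scalerA.
Qed.

Lemma orbit_op_cyclic w : orbit_op w v0 = w.
Proof.
have sE : [seq rho g v0 | g <- s] = orbit_tuple.
  by rewrite -[LHS]/(map _ (in_tuple s)) -map_tnth_enum -map_comp.
rewrite [RHS](@coord_span _ _ _ orbit_tuple); last first.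
  by rewrite -sE span_s memvf.
rewrite /orbit_op sum_lfunE; apply: eq_bigr => i _.
by rewrite scale_lfunE -tnth_nth tnth_mktuple.
Qed.

Lemma repr_comm g h v : rho g (rho h v) = rho h (rho g v).
Proof. by rewrite -!comp_lfunE -!repr_funM commG. Qed.

Lemma orbit_op_repr w g v : orbit_op w (rho g v) = rho g (orbit_op w v).
Proof.
rewrite /orbit_op !sum_lfunE linear_sum; apply: eq_bigr => i _.
by rewrite !scale_lfunE linearZ repr_comm.
Qed.

Lemma orbit_op_comm x y v :
  orbit_op x (orbit_op y v) = orbit_op y (orbit_op x v).
Proof.
(* Of [orbit_op x] only its commutation with the action of [G] is kept, so that unfolding expands
   [orbit_op y] alone. *)
move: (orbit_op x) (orbit_op_repr x) => f f_repr.
rewrite /orbit_op !sum_lfunE linear_sum; apply: eq_bigr => i _.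
by rewrite !scale_lfunE linearZ /= f_repr.
Qed.

Definition orbit_mul (x y : V) : V := orbit_op x y.

(** Write [y] as [orbit_op y v0] and swap the two commuting operators; then [orbit_op x v0] is
    [x]. *)
Lemma orbit_mulC : commutative orbit_mul.
Proof.
move=> x y; rewrite /orbit_mul -{1}[y]orbit_op_cyclic orbit_op_comm.
by rewrite orbit_op_cyclic.
Qed.

(** By commutativity the claim becomes x(zy) = z(xy), which is the commutation of [orbit_op x] with
    [orbit_op z]. *)
Lemma orbit_mulA : associative orbit_mul.
Proof.
move=> x y z; rewrite [RHS]orbit_mulC [orbit_mul y z]orbit_mulC.
exact: orbit_op_comm.
Qed.

Lemma orbit_mul1 : left_id v0 orbit_mul.
Proof. by move=> x; rewrite orbit_mulC; apply: orbit_op_cyclic. Qed.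

Lemma orbit_mul_linear y : linear (orbit_mul ^~ y).
Proof.
by move=> k a b; rewrite /orbit_mul orbit_op_linear add_lfunE scale_lfunE.
Qed.

Definition orbit_alg : finComAlg K :=
  FinComAlg orbit_mulA orbit_mulC orbit_mul1 orbit_mul_linear.

(** [orbit_op x] commutes with [rho g] and sends [v0] to [x]. This identity later gives the
    invertibility of [rho g v0], the multiplicativity and injectivity of the embedding, and the
    module isomorphism. *)
Lemma orbit_mul_repr g x : orbit_mul (rho g v0) x = rho g x.
Proof. by rewrite orbit_mulC /orbit_mul orbit_op_repr orbit_op_cyclic. Qed.

Lemma reprVK g : rho g (rho g^-1%g v0) = v0.
Proof. by rewrite -comp_lfunE -repr_funM mulgV repr_fun1 id_lfunE. Qed.

Lemma orbit_unit_subproof g :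
  (rho g v0 : orbit_alg) * (rho g^-1%g v0 : orbit_alg) = 1.
Proof. exact: etrans (orbit_mul_repr _ _) (reprVK g). Qed.

Definition orbit_unit (g : G) : unit_group orbit_alg :=
  unit_pair (orbit_unit_subproof g).

Lemma orbit_unitM : {morph orbit_unit : g h / (g * h)%g}.
Proof.
move=> g h; apply: unit_val_inj.
apply: etrans (esym (orbit_mul_repr g (rho h v0))).
by rewrite -comp_lfunE -repr_funM.
Qed.

Lemma orbit_unit_morphism : variety_morphism orbit_unit.
Proof.
have reg (xi : {linear V -> K^o}) : regular (fun g => xi (rho g v0)).
  have [p pE] := repr_fun_regular rho (linfun xi) v0.
  by exists p => g; rewrite -pE lfunE.
(* A point of the unit group also records its inverse, whose coordinates are matrix coefficients
   pulled back along the inversion of [G]. *)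
have regV (xi : {linear V -> K^o}) : regular (fun g => xi (rho g^-1%g v0)).
  exact: (@invg_morphism K G _ (reg xi)).
pose cf j : {linear orbit_alg -> K^o} := coord (vbasis {:orbit_alg}) j.
apply: regular_comp => i; case: (split_ordP i) => j ->.
  have [p pE] := reg (cf j).
  by exists p => g; rewrite -pE; apply: unit_acoordl.
have [p pE] := regV (cf j).
by exists p => g; rewrite -pE; apply: unit_acoordr.
Qed.

Definition orbit_hom : alg_group_hom G (unit_group orbit_alg) :=
  AlgGroupHom orbit_unitM orbit_unit_morphism.

(** The vector [rho g v0] determines the operator [rho g], so if [g] and [h] have the same image,
    then [g^-1 * h] acts trivially. *)
Lemma orbit_hom_inj : effective rho -> injective orbit_hom.
Proof.
move=> eff g h e; have gh : rho g v0 = rho h v0 := congr1 (@unit_val _ _) e.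
apply: (@mulgI _ g^-1%g); rewrite mulVg; apply/esym/eff => v.
have ghv : rho g v = rho h v by rewrite -(orbit_mul_repr g) gh orbit_mul_repr.
by rewrite repr_funM comp_lfunE -ghv -comp_lfunE -repr_funM mulVg repr_fun1
  id_lfunE.
Qed.

Lemma orbit_repr_iso : repr_iso rho (restrict_repr orbit_hom (unit_repr orbit_alg)).
Proof.
(* The underlying space of [orbit_alg] is [V] itself, so the identity can serve as the
   isomorphism. *)
exists (\1%VF : 'Hom(V, V)); split; first by exists id => v; rewrite id_lfunE.
move=> g v; rewrite !id_lfunE.
exact: etrans (esym (orbit_mul_repr g v)) (esym (unit_actE (orbit_unit g) _)).
Qed.

End OrbitAlgebra.

Theorem proposition4 (K : closedFieldType) (charK0 : [pchar K] =i pred0)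
    (G : linAlgGroupType K) (commG : forall g h : G, commute g h)
    (V : vectType K) (rho : rational_repr G V)
    (cyclV : cyclic_repr rho) (effV : effective rho) :
  exists (A : finComAlg K) (phi : alg_group_hom G (unit_group A)),
    injective phi /\ repr_iso rho (restrict_repr phi (unit_repr A)).
Proof.
have [v0 /cyclic_vector_spanning_seq[s span_s]] := cyclV.
exists (orbit_alg commG span_s), (orbit_hom commG span_s).
by split; [apply: orbit_hom_inj | apply: orbit_repr_iso].
Qed.
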